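(* In the binary model, suppose $\lambda=1/\theta$ where $\theta$ is a Pisot number. Then almost surely $S$ is disconnected and has no isolated gaps; more precisely, almost surely, for every connected component $(\alpha,\beta)$ of $\mathbb{R}\setminus S$: if $\alpha>-\infty$ then $(\alpha-\varepsilon,\alpha)\not\subset S$ for every $\varepsilon>0$, and if $\beta<\infty$ then $(\beta,\beta+\varepsilon)\not\subset S$ for every $\varepsilon>0$.
   Context: Binary model. Let $T=\{1,2\}^*$ be the set of finite words over $\{1,2\}$ (the rooted binary tree; $v|j$ is the prefix of $v$ of length $j$). Let $\{a_v\}_{v\in T,\,|v|\ge1}$ be i.i.d. random variables with $\mathbb{P}(a_v=0)=\mathbb{P}(a_v=1)=\frac12$. Fix $\lambda\in(0,1)$. For $\omega\in\{1,2\}^{\mathbb{N}}$ put $f(\omega)=\sum_{j\ge1}a_{\omega|j}\lambda^j$. Let $\mu$ be the image under $f$ of the uniform product measure on $\{1,2\}^{\mathbb{N}}$, and $S=f(\{1,2\}^{\mathbb{N}})$ its (random, compact) support. A Pisot number is an algebraic integer $\theta>1$ all of whose Galois conjugates have absolute value strictly less than $1$. *)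

(* Defs.v *)
From HB Require Import structures.
From mathcomp Require Import all_boot all_order all_algebra.
From mathcomp Require Import all_classical all_reals all_analysis.
From mathcomp Require Import complex.
Set Implicit Arguments. Unset Strict Implicit. Unset Printing Implicit Defensive.
Import Order.TTheory GRing.Theory Num.Theory.
Import numFieldNormedType.Exports.
Local Open Scope classical_set_scope.
Local Open Scope ring_scope.

(* Pisot number: an algebraic integer theta > 1 all of whose Galois conjugates
   (the other complex roots of its minimal polynomial over Q) have modulus < 1.
   The minimal polynomial of an algebraic integer is a monic integer polynomial
   irreducible over Q. *)
Definition pisot (R : realType) (theta : R) : Prop :=
  1 < theta /\
  exists p : {poly int},
    p \is monic /\
    irreducible_poly (map_poly (intr : int -> rat) p) /\
    root (map_poly (intr : int -> R) p) theta /\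
    forall z : R[i], root (map_poly (intr : int -> R[i]) p) z ->
      z != (theta%:C)%C -> `|z| < 1.

(* Words of T = {1,2}^* are encoded as seq bool (false ~ 1, true ~ 2).
   For omega in {1,2}^N (encoded nat -> bool), omega|j = prefix of length j. *)
Definition prefix (omega : nat -> bool) (j : nat) : seq bool := mkseq omega j.

Definition indep_words d (T : measurableType d) (R : realType)
    (P : probability T R) (a : seq bool -> T -> R) : Prop :=
  forall (J : seq (seq bool)), uniq J -> all (fun v => 0 < size v)%N J ->
  forall B : seq bool -> set R, (forall v, measurable (B v)) ->
    P (\big[setI/setT]_(v <- J) (a v @^-1` B v)) =
    \big[*%E/1%E]_(v <- J) P (a v @^-1` B v).

Definition binary_model d (T : measurableType d) (R : realType)
    (P : probability T R) (a : seq bool -> T -> R) : Prop :=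
  (forall v, (0 < size v)%N -> measurable_fun setT (a v)) /\
  (forall v, (0 < size v)%N -> P (a v @^-1` [set 0]) = (2^-1)%:E) /\
  (forall v, (0 < size v)%N -> P (a v @^-1` [set 1]) = (2^-1)%:E) /\
  indep_words P a.

Definition fmap d (T : measurableType d) (R : realType)
    (a : seq bool -> T -> R) (lambda : R) (t : T) (omega : nat -> bool) : R :=
  limn (fun n => \sum_(1 <= j < n) a (prefix omega j) t * lambda ^+ j).

Definition attractor d (T : measurableType d) (R : realType)
    (a : seq bool -> T -> R) (lambda : R) (t : T) : set R :=
  range (fmap a lambda t).

Definition eitv (R : realType) (alpha beta : \bar R) : set R :=
  [set x : R | (alpha < x%:E)%E /\ (x%:E < beta)%E].

(* Main.v *)
Require Import Defs.
From HB Require Import structures.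
From mathcomp Require Import all_boot all_order all_algebra.
From mathcomp Require Import all_classical all_reals all_analysis.
From mathcomp Require Import complex.
From mathcomp Require Import lra ring zify.
Set Implicit Arguments. Unset Strict Implicit. Unset Printing Implicit Defensive.
Import Order.TTheory GRing.Theory Num.Theory.
Import numFieldNormedType.Exports.
Local Open Scope classical_set_scope.
Local Open Scope ring_scope.

(** Let [X_v] be the partial sum of the series along the word [v].  Since
    [theta] is Pisot, two distinct values of [X] on words of length [m] differ by
    at least [c * lambda ^ m] (Garsia).  Fix a rational [r] in a gap and follow
    the words of length [n] minimising [X] among those with [X_v >= r]: as long as
    some descendant has only zero bits, the number of these descendants is a
    critical binary branching process, which dies out almost surely.  In one
    generation, leaving exactly one survivor is at least as likely as dying, so
    with probability bounded below the process passes through a single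
    particle, which then has a descent of zeros during [K] generations.  At that
    moment all other words are at distance at least [c * lambda ^ m] from the
    minimum, whereas the descendants of the particle fill at most
    [lambda ^ (m + K) / (theta - 1)], which is less for [K] large: there is a hole
    right next to the minimum, at scale [lambda ^ m].  This happens at infinitely
    many scales almost surely, for all rational [r].  Left ends of the gaps are
    handled by exchanging zeros and ones, which reflects the support. *)

(** * Separation of the values of integer polynomials at a Pisot number *)

Lemma horner_char_poly (F : comNzRingType) n (A : 'M[F]_n) (y : F) :
  (char_poly A).[y] = \det (y%:M - A).
Proof.
rewrite /char_poly -horner_evalE -det_map_mx; congr (\det _).
apply/matrixP => i j; rewrite !mxE /= horner_evalE hornerD hornerN hornerC.
by rewrite hornerMn hornerX.
Qed.

(** Split [q] into linear factors: the determinant of [A - y] is, up to sign, [char_poly A] at [y].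
    Exchanging the two products regroups the factors by eigenvalue, and the sign is spread over
    [zs]. *)
Lemma det_horner_mx (F : closedFieldType) n (A : 'M[F]_n.+1) (zs : seq F)
    (q : {poly F}) :
  char_poly A = \prod_(z <- zs) ('X - z%:P) ->
  \det (horner_mx A q) = \prod_(z <- zs) q.[z].
Proof.
move=> charA; have [ys ->] := closed_field_poly_normal q.
have szA : size zs = n.+1.
  have := size_prod_XsubC zs id; rewrite -charA size_char_poly /=.
  by case.
rewrite linearZ /= detZ rmorph_prod /= (big_morph _ (@det_mulmx F n.+1) (det1 _ _)).
under [RHS]eq_bigr do rewrite hornerZ horner_prod.
rewrite big_split /= big_const_seq iter_mulr_1 count_predT szA; congr (_ * _).
rewrite exchange_big /=; apply: eq_bigr => y _.
rewrite rmorphB /= horner_mx_X horner_mx_C -opprB -scaleN1r detZ -horner_char_poly charA.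
rewrite horner_prod -szA -(count_predT zs) -iter_mulr_1 -big_const_seq -big_split /=.
by apply: eq_bigr => z _; rewrite !hornerXsubC mulN1r opprB.
Qed.

Section Garsia.
Variables (R : rcfType) (theta : R) (p : {poly int}).
Hypothesis p_monic : p \is monic.
Hypothesis p_irr : irreducible_poly (map_poly (intr : int -> rat) p).
Hypothesis p_theta : root (map_poly (intr : int -> R) p) theta.

Let toC := (intr : int -> R[i]).

Lemma map_intr_real_complex (q : {poly int}) :
  map_poly (real_complex R) (map_poly intr q) = map_poly toC q.
Proof.
by rewrite -map_poly_comp; apply: eq_map_poly => z /=; rewrite rmorph_int.
Qed.

(** Over the rationals [p] either divides [q] or is coprime to it, and coprimality survives the
    passage to the complex numbers, where it forbids a common root. *)
Lemma conjugate_root_eq0 (q : {poly int}) (z : R[i]) :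
  root (map_poly toC p) z -> root (map_poly toC q) z ->
  root (map_poly (intr : int -> R) q) theta.
Proof.
have CE (r : {poly int}) : map_poly (ratr : rat -> R[i]) (map_poly intr r) = map_poly toC r.
  by rewrite -map_poly_comp; apply: eq_map_poly => k /=; rewrite ratr_int.
have RE (r : {poly int}) : map_poly (ratr : rat -> R) (map_poly intr r) = map_poly intr r.
  by rewrite -map_poly_comp; apply: eq_map_poly => k /=; rewrite ratr_int.
move=> pz qz; have := irreducible_poly_coprime (map_poly intr q) p_irr.
case: (boolP (_ %| _)) => [pq _|_ /=].
  move: pq; rewrite -(dvdp_map (ratr : {rmorphism rat -> R})) !RE => pq.
  by case/dvdpP: pq => r ->; rewrite rootM p_theta orbT.
rewrite -(coprimep_map (ratr : {rmorphism rat -> R[i]})) !CE => cpq.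
by have := coprimep_root cpq pz; rewrite (eqP qz) eqxx.
Qed.

(** The product is the absolute value of the determinant of [q] at the companion matrix of [p],
    hence a natural number. If it vanished, [q] would vanish at a conjugate, hence at [theta]. *)
Lemma prod_conjugates_ge1 (zs : seq R[i]) (q : {poly int}) :
  map_poly toC p = \prod_(z <- zs) ('X - z%:P) ->
  ~~ root (map_poly (intr : int -> R) q) theta ->
  1 <= \prod_(z <- zs) `|(map_poly toC q).[z]|.
Proof.
move=> pE q0; have p1 : (1 < size p)%N.
  have [] := p_irr; rewrite size_map_poly_id0 //.
  by rewrite (monicP p_monic) intr_eq0 oner_eq0.
have [n sp] : exists n, (size p).-1 = n.+1.
  by exists (size p).-2; case: (size p) p1 => // -[|].
have [A Achar] : exists A : 'M[int]_n.+1, char_poly A = p.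
  have := companionmxK p_monic; move: (companionmx p); rewrite sp => A ?.
  by exists A.
have detE : (\det (horner_mx A q))%:~R = \prod_(z <- zs) (map_poly toC q).[z].
  rewrite -(@det_horner_mx _ _ (map_mx toC A)) -?map_horner_mx -?map_char_poly ?Achar //.
  by rewrite det_map_mx.
rewrite -normr_prod -detE -intr_norm ler1z -gtz0_ge1 normr_gt0.
apply: contraNneq q0 => d0; move: detE; rewrite d0 => /esym/eqP.
rewrite prodf_seq_eq0 => /hasP[z zzs /= qz].
by apply: (@conjugate_root_eq0 _ z); rewrite // pE root_prod_XsubC.
Qed.

Lemma norm_horner_le_geometric (q : {poly int}) (z : R[i]) :
  (forall i, `|q`_i| <= 1) -> `|z| < 1 ->
  `|(map_poly toC q).[z]| <= (1 - `|z|)^-1.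
Proof.
move=> q1 z1; rewrite horner_coef; apply: (le_trans (ler_norm_sum _ _ _)).
have zge0 : 0 < 1 - `|z| by rewrite subr_gt0.
apply: (@le_trans _ _ (\sum_(i < size (map_poly toC q)) `|z| ^+ i)).
  apply: ler_sum => i _; rewrite normrM normrX coef_map /= -intr_norm.
  by rewrite ler_piMl ?exprn_ge0 // -(mulr1z 1) ler_int.
rewrite -[leRHS]mul1r ler_pdivlMr // mulrC -opprB mulNr -subrX1 opprB.
by rewrite lerBlDr lerDl exprn_ge0.
Qed.

(* The conjugates contribute a bounded factor each to the norm of [q(theta)],
   which is a nonzero integer. *)
Lemma garsia_separation :
  (forall z : R[i], root (map_poly toC p) z -> z != (theta%:C)%C -> `|z| < 1) ->
  exists2 c : R, 0 < c & forall q : {poly int}, (forall i, `|q`_i| <= 1) ->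
    (map_poly (intr : int -> R) q).[theta] != 0 ->
    c <= `|(map_poly (intr : int -> R) q).[theta]|.
Proof.
move=> conj; have [zs] := closed_field_poly_normal (map_poly toC p).
rewrite lead_coef_map_id0 ?(monicP p_monic) // ?scale1r => [pE|]; last first.
  by rewrite intr_eq0 oner_eq0.
(* [C^-1] is the product of the geometric-series bounds over the conjugates other than [theta]. *)
pose C : R[i] := \prod_(z <- zs | z != (theta%:C)%C) (1 - `|z|).
have C0 : 0 < C.
  rewrite /C big_seq_cond prodr_gt0 // => z /andP[zzs zt]; rewrite subr_gt0 conj //.
  by rewrite pE root_prod_XsubC.
have rE : (complex.Re C)%:C%C = C by rewrite RRe_real // ger0_real // ltW.
have tzs : (theta%:C)%C \in zs.
  rewrite -root_prod_XsubC -pE -map_intr_real_complex.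
  by rewrite rootE horner_map (eqP p_theta) rmorph0.
exists (Order.min 1 (complex.Re C)).
  by rewrite lt_min ltr01 -ltcR rE.
move=> q q1 qt; have := prod_conjugates_ge1 pE qt.
set y := _.[theta] in qt *.
rewrite ge_min; case: (leP 1 `|y|) => //= y1.
have yE : `|(map_poly toC q).[(theta%:C)%C]| = (`|y|)%:C%C.
  by rewrite -map_intr_real_complex horner_map /= normc_def /= expr0n addr0 sqrtr_sqr.
rewrite (bigID (fun z => z == (theta%:C)%C)) /=.
rewrite [X in X * _](eq_bigr (fun=> (`|y|)%:C%C)); last by move=> z /eqP ->.
(* The multiplicity [k] of [theta] among the roots is not computed: [k >= 1] and [|y| < 1] already
   give [|y| ^+ k <= |y|]. *)
rewrite big_const_seq iter_mulr_1; set k := count _ _ => le1.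
have k0 : (0 < k)%N by rewrite -has_count; apply/hasP; exists (theta%:C)%C.
have yk : (`|y|)%:C%C ^+ k <= (`|y|)%:C%C.
  by rewrite -rmorphXn lecR -[leRHS]expr1 ler_wiXn2l // ltW.
have Cle : \prod_(z <- zs | z != (theta%:C)%C) `|(map_poly toC q).[z]| <= C^-1.
  rewrite /C -prodfV big_seq_cond [leRHS]big_seq_cond; apply: ler_prod => z /andP[zzs zt].
  rewrite normr_ge0 norm_horner_le_geometric // conj //.
  by rewrite pE root_prod_XsubC.
rewrite -lecR rE -[leLHS]mul1r -ler_pdivlMr //; apply: (le_trans le1).
by apply: ler_pM => //; rewrite ?exprn_ge0 ?prodr_ge0 // ler0c.
Qed.
End Garsia.

(** * Averages over finitely many bits *)

Section BitAverage.
Variables (R : realFieldType) (I : eqType).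
Implicit Types (x y : I -> bool) (J U : seq I) (F G : (I -> bool) -> R).

Definition set_bit x v b : I -> bool := fun u => if u == v then b else x u.

(** A finite form of conditional expectation: the coordinates in [J] are resampled as independent
    fair bits, the others stay as in [x]. *)
Fixpoint bit_avg J F x : R :=
  if J is v :: J' then
    (bit_avg J' F (set_bit x v false) + bit_avg J' F (set_bit x v true)) / 2
  else F x.

Definition agree_off J x y := forall u, u \notin J -> y u = x u.

Lemma agree_off_set_bit J x y v b :
  agree_off J (set_bit x v b) y -> agree_off (v :: J) x y.
Proof.
by move=> xy u; rewrite inE negb_or => /andP[uv uJ]; rewrite xy // /set_bit (negPf uv).
Qed.

Lemma bit_avg_le J F G x :
  (forall y, agree_off J x y -> F y <= G y) -> bit_avg J F x <= bit_avg J G x.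
Proof.
elim: J x => [|v J IH] x FG /=; first exact: FG.
rewrite ler_pM2r ?invr_gt0 ?ltr0n //.
by apply: lerD; apply: IH => y xy; apply: FG; apply: agree_off_set_bit xy.
Qed.

Lemma eq_bit_avg J F G x :
  (forall y, agree_off J x y -> F y = G y) -> bit_avg J F x = bit_avg J G x.
Proof. by move=> FG; apply/le_anti; rewrite !bit_avg_le// => y /FG ->. Qed.

Lemma bit_avg_cat J U F x : bit_avg (J ++ U) F x = bit_avg J (bit_avg U F) x.
Proof. by elim: J x => //= v J IH x; rewrite !IH. Qed.

Lemma bit_avgD J F G x :
  bit_avg J (fun y => F y + G y) x = bit_avg J F x + bit_avg J G x.
Proof. by elim: J x => //= v J IH x; rewrite !IH; lra. Qed.

Lemma bit_avgZ J c F x : bit_avg J (fun y => c * F y) x = c * bit_avg J F x.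
Proof. by elim: J x => //= v J IH x; rewrite !IH; lra. Qed.

Lemma bit_avg_cst J c x : bit_avg J (fun=> c) x = c.
Proof. by elim: J x => //= v J IH x; rewrite !IH; lra. Qed.

(** Independence: the factors read distinct coordinates, so averaging one coordinate acts on at most
    one factor. *)
Lemma bit_avg_prod J U (g : I -> bool -> R) x :
  uniq J -> uniq U -> {subset U <= J} ->
  bit_avg J (fun y => \prod_(u <- U) g u (y u)) x =
  \prod_(u <- U) ((g u false + g u true) / 2).
Proof.
elim: J U x => [|v J IH] U x /=.
  by case: U => [|u U] _ _ sU; rewrite ?big_nil //; have := sU u (mem_head _ _).
move=> /andP[vJ uJ] uU sU; have [vU|vU] := boolP (v \in U); last first.
  have sJ : {subset U <= J}.
    move=> u uU'; have := sU u uU'; rewrite inE => /predU1P[uv|//].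
    by rewrite -uv uU' in vU.
  by rewrite !IH //; lra.
have sU' : {subset rem v U <= J}.
  by move=> u; rewrite mem_rem_uniq // inE => /andP[uv /sU]; rewrite inE (negPf uv).
have E b : bit_avg J (fun y => \prod_(u <- U) g u (y u)) (set_bit x v b) =
    g v b * bit_avg J (fun y => \prod_(u <- rem v U) g u (y u)) (set_bit x v b).
  rewrite -bit_avgZ; apply: eq_bit_avg => y xy.
  by rewrite (big_rem v) //= xy // /set_bit eqxx.
by rewrite !E !IH ?rem_uniq // (big_rem v vU) /=; ring.
Qed.

End BitAverage.

(** * Binary words, generations and the branching process *)

Section Words.

Definition words n : seq (seq bool) := [seq val t | t <- enum {: n.-tuple bool}].

Lemma mem_words n (w : seq bool) : (w \in words n) = (size w == n).
Proof.
apply/mapP/eqP => [[t _ ->]|wn]; first exact: size_tuple.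
by exists (Tuple (introT eqP wn)); rewrite ?mem_enum.
Qed.

Lemma words_uniq n : uniq (words n).
Proof. by rewrite map_inj_uniq ?enum_uniq //; apply: val_inj. Qed.

Lemma size_words n : size (words n) = (2 ^ n)%N.
Proof. by rewrite size_map -cardE card_tuple card_bool. Qed.

(** The bits read by the [k] generations after generation [n]; level [n] itself is left out, so
    consecutive blocks are disjoint. *)
Definition levels n k : seq (seq bool) := flatten [seq words i | i <- iota n.+1 k].

Lemma levelsS n k : levels n k.+1 = words n.+1 ++ levels n.+1 k.
Proof. by []. Qed.

Lemma levelsD n j k : levels n (j + k) = levels n j ++ levels (n + j) k.
Proof. by rewrite /levels iotaD map_cat flatten_cat addSn. Qed.

Lemma mem_levels n k (w : seq bool) : (w \in levels n k) = (n < size w <= n + k)%N.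
Proof.
elim: k n => [|k IH] n; first by rewrite addn0 ltnNge andNb.
by rewrite levelsS mem_cat mem_words IH; lia.
Qed.

Lemma levels_uniq n k : uniq (levels n k).
Proof.
elim: k n => [|k IH] n //; rewrite levelsS cat_uniq words_uniq IH andbT /=.
by apply/hasPn => w; rewrite mem_levels mem_words; lia.
Qed.

Definition children (V : seq (seq bool)) : seq (seq bool) :=
  flatten [seq [:: rcons v false; rcons v true] | v <- V].

Lemma size_children V : size (children V) = (2 * size V)%N.
Proof. by elim: V => //= v V; rewrite /children => ->; lia. Qed.

Lemma mem_children V v b : (rcons v b \in children V) = (v \in V).
Proof.
elim: V => //= u V IH; rewrite /children /= !inE -/(children V) IH.
by rewrite !eqseq_rcons orbA -andb_orr; case: (b) => /=; rewrite andbT.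
Qed.

Lemma childrenP V u : u \in children V -> exists v b, v \in V /\ u = rcons v b.
Proof.
case/flatten_mapP => v vV; rewrite !inE => /orP[]/eqP ->; by exists v; eexists.
Qed.

Lemma children_uniq V : uniq V -> uniq (children V).
Proof.
elim: V => //= v V IH /andP[vV uV]; rewrite /children /= !inE -/(children V).
by rewrite eqseq_rcons andbF /= !mem_children (negPf vV) IH.
Qed.

Lemma children_size n V : all (fun v => size v == n) V ->
  all (fun v => size v == n.+1) (children V).
Proof.
move=> /allP sV; apply/allP => u /childrenP[v [b [/sV vn ->]]].
by rewrite size_rcons eqSS.
Qed.

(** One generation of the branching process: a child survives when its bit is zero, that is, when it
    keeps the position of its parent. *)
Definition zero_children (x : seq bool -> bool) V := [seq u <- children V | ~~ x u].

Definition below K (w : seq bool) : seq (seq bool) := [seq w ++ u | u <- levels 0 K].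

Lemma below_uniq K w : uniq (below K w).
Proof.
rewrite map_inj_uniq ?levels_uniq // => u v /eqP.
by rewrite eqseq_cat // eqxx => /eqP.
Qed.

Lemma below_size K (w u : seq bool) : u \in below K w -> (size w < size u <= size w + K)%N.
Proof. by case/mapP => v; rewrite mem_levels => vK ->; rewrite size_cat; lia. Qed.

(* [V] carries the particles sitting at the minimum; a hole appears when a
   single one is left and produces only zeros during [K] generations. *)
Fixpoint hole K h (V : seq (seq bool)) (x : seq bool -> bool) : bool :=
  if h is h'.+1 then
    let V' := zero_children x V in
    (if V' is [:: w] then all (fun u => ~~ x u) (below K w) else false)
      || hole K h' V' x
  else false.

Lemma eq_zero_children V x y :
  {in children V, x =1 y} -> zero_children x V = zero_children y V.
Proof. by move=> xy; apply: eq_in_filter => u /xy ->. Qed.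

Lemma zero_children_size n V x : all (fun v => size v == n) V ->
  all (fun v => size v == n.+1) (zero_children x V).
Proof.
move=> /children_size/allP V1; apply/allP => u.
by rewrite mem_filter => /andP[_ /V1].
Qed.

Lemma eq_hole K h n V x y : all (fun v => size v == n) V ->
  (forall u, (n < size u <= n + h + K)%N -> x u = y u) ->
  hole K h V x = hole K h V y.
Proof.
elim: h n V => //= h IH n V sV xy.
have -> : zero_children x V = zero_children y V.
  apply: eq_zero_children => u /(allP (children_size sV)) /= /eqP un.
  by apply: xy; lia.
have sV' := zero_children_size y sV.
congr (_ || _); last by apply: (IH n.+1) => // u un; apply: xy; lia.
case E: (zero_children y V) => [|w [|]] //; apply: eq_in_all => u /below_size uw.
rewrite xy //; have := allP sV' w; rewrite E mem_head => /(_ isT) /eqP wn.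
by move: uw; rewrite wn; lia.
Qed.
End Words.

(** * Lower bound for the probability of a hole *)

Section Hole.
Variable R : realFieldType.

(** Probability that the process started from one particle is extinct after [h] generations: each of
    the two children is killed at once or starts a process with one generation less. *)
Fixpoint ext_prob h : R := if h is h'.+1 then ((1 + ext_prob h') / 2) ^+ 2 else 0.

Lemma ext_prob_itv h : 0 <= ext_prob h <= 1.
Proof.
elim: h => [|h /andP[q0 q1]] /=; first by rewrite lexx ler01.
move: (ext_prob h) q0 q1 => q q0 q1; rewrite sqr_ge0 /= expr_le1 //; lra.
Qed.

(** The survival probability [s] evolves by [s - s ^+ 2 / 4], hence decays like [4 / h]; the shift
    by 4 makes the bound exact at [h = 0]. *)
Lemma ext_prob_ge h : 1 - 4 / (h%:R + 4) <= ext_prob h.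
Proof.
elim: h => [|h IH] /=; first by rewrite mulr0n add0r divff ?subrr // pnatr_eq0.
have /andP[q0 q1] := ext_prob_itv h.
have h0 : (0 : R) <= h%:R by [].
move: IH; set q := ext_prob h in q0 q1 *.
rewrite -[h.+1%:R]natr1; move: (h%:R) h0 => z z0 IH.
have z4 : 0 < z + 4 by lra.
have z5 : 0 < z + 1 + 4 by lra.
have le1 : 1 - 2 / (z + 4) <= (1 + q) / 2 by move: IH; move: (z + 4)^-1 => i; lra.
have g0 : 0 <= 1 - 2 / (z + 4).
  by rewrite subr_ge0 ler_pdivrMr //; lra.
apply: (@le_trans _ _ ((1 - 2 / (z + 4)) ^+ 2)); last first.
  by rewrite lerXn2r // nnegrE; apply: le_trans le1.
rewrite -subr_ge0.
have -> : (1 - 2 / (z + 4)) ^+ 2 - (1 - 4 / (z + 1 + 4)) = 4 / ((z + 4) ^+ 2 * (z + 1 + 4)).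
  by field; rewrite !lt0r_neq0.
by rewrite divr_ge0 // mulr_ge0 // ?sqr_ge0 // ltW.
Qed.

(** Each of [2 ^ n] particles survives [8 * 2 ^ n] generations with probability at most
    [4 / (8 * 2 ^ n + 4)], so by Bernoulli's inequality all die out with probability at least one
    half. This fixes the time scale used later. *)
Lemma ext_prob_pow_ge n : 2^-1 <= ext_prob (2 ^ (n + 3)) ^+ (2 ^ n).
Proof.
have /andP[q0 q1] := ext_prob_itv (2 ^ (n + 3)).
have := ext_prob_ge (2 ^ (n + 3)); move: (ext_prob _) q0 q1 => q q0 q1 ge.
have bern m : 1 - m%:R * (1 - q) <= q ^+ m.
  elim: m => [|m IH]; first by rewrite mul0r subr0 expr0.
  rewrite exprS -[m.+1%:R]natr1; have m0 : (0 : R) <= m%:R by [].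
  have := ler_wpM2l q0 IH; apply: le_trans.
  rewrite -subr_ge0 [X in 0 <= X](_ : _ = m%:R * (1 - q) ^+ 2); last by ring.
  by rewrite mulr_ge0 // sqr_ge0.
apply: le_trans (bern _); have p0 : (0 : R) < (2 ^ n)%:R by rewrite ltr0n expn_gt0.
move: ge; rewrite expnD natrM; move: ((2 ^ n)%:R) p0 => z z0.
have z4 : 0 < z * (2 ^ 3)%:R + 4 by rewrite (_ : (2 ^ 3)%:R = 8) //; lra.
move=> ge; have : z * (1 - q) <= z * (4 / (z * (2 ^ 3)%:R + 4)).
  by apply: ler_wpM2l; lra.
suff : z * (4 / (z * (2 ^ 3)%:R + 4)) <= 2^-1 by lra.
by rewrite mulrA ler_pdivrMr // (_ : (2 ^ 3)%:R = 8) //; lra.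
Qed.

Definition zero_prob K : R := (2^-1) ^+ size (levels 0 K).

Lemma zero_prob_gt0 K : 0 < zero_prob K.
Proof. by rewrite exprn_gt0 // invr_gt0. Qed.

Lemma prod_indicator (I : eqType) (U : seq I) (P : pred I) :
  \prod_(u <- U) (P u)%:R = (all P U)%:R :> R.
Proof.
elim: U => [|u U IH]; first by rewrite big_nil.
by rewrite big_cons IH /= -natrM mulnb.
Qed.

Lemma avg_all_zero K h n w x : size w = n ->
  bit_avg (levels n (h + K)) (fun y => (all (fun u => ~~ y u) (below K w))%:R) x
  = zero_prob K.
Proof.
move=> wn; under eq_bit_avg do rewrite -prod_indicator.
rewrite (bit_avg_prod (fun _ b => (~~ b)%:R)) ?levels_uniq ?below_uniq //.
  rewrite (eq_bigr (fun=> 2^-1)) => [|u _]; last by rewrite /=; lra.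
  by rewrite big_const_seq iter_mulr_1 count_predT size_map.
by move=> u /below_size; rewrite mem_levels wn; lia.
Qed.

(* Induction on the first generation.  The configuration where only the head
   child has bit zero, which leaves one particle, is as likely as extinction;
   it pays for the case where the induction hypothesis says nothing. *)
Lemma avg_hole_ge K h n V x : uniq V -> V != [::] -> all (fun v => size v == n) V ->
  zero_prob K / 2 * ext_prob h ^+ size V <=
  bit_avg (levels n (h + K)) (fun y => (hole K h V y)%:R) x.
Proof.
have k0 := zero_prob_gt0 K.
have avg_ge0 J (F : (seq bool -> bool) -> bool) y : 0 <= bit_avg J (fun z => (F z)%:R : R) y.
  by rewrite -[leLHS](@bit_avg_cst R _ J 0 y); apply: bit_avg_le.
elim: h n V x => [|h IH] n V x uV V0 sV.
  by rewrite /= expr0n size_eq0 (negPf V0) mulr0; apply: (avg_ge0 _ (fun=> false)).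
rewrite addSn levelsS bit_avg_cat.
have /andP[q0 q1] := ext_prob_itv h; set q := ext_prob h in q0 q1 IH *.
have U0 : children V != [::] by rewrite -size_eq0 size_children muln_eq0 /= size_eq0.
have uU := children_uniq uV; have sU := children_size sV.
have [w0 [U' UE]] : exists w0 U', children V = w0 :: U'.
  by case: (children V) U0 => // w0 U' _; exists w0, U'.
(* [G] is a minorant reading the first generation only. Its first term averages to the claimed
   bound; the other two, for the lone survivor [w0] and for extinction, have opposite averages.
   Pointwise, [G] is 0 at extinction, at most [zero_prob K] with one survivor, and at most the
   induction bound otherwise. *)
pose G (y : seq bool -> bool) : R :=
  zero_prob K / 2 * (\prod_(u <- children V) (if y u then 1 else q)) +
  (zero_prob K / 2 * (\prod_(u <- children V) (y u == (u != w0))%:R) +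
   - (zero_prob K / 2) * (\prod_(u <- children V) (y u)%:R)).
have subU : {subset children V <= words n.+1}.
  by move=> u /(allP sU); rewrite mem_words.
have -> : zero_prob K / 2 * ext_prob h.+1 ^+ size V = bit_avg (words n.+1) G x.
  rewrite /G !bit_avgD !bit_avgZ.
  rewrite (bit_avg_prod (fun _ b => if b then 1 else q)) ?words_uniq //.
  rewrite (bit_avg_prod (fun u b => (b == (u != w0))%:R)) ?words_uniq //.
  rewrite (bit_avg_prod (fun _ b => (nat_of_bool b)%:R)) ?words_uniq //.
  rewrite [X in _ + (_ * X + _)](eq_bigr (fun=> 2^-1)) => [|u _]; last first.
    by case: (u != w0) => /=; lra.
  rewrite [X in _ + (_ + _ * X)](eq_bigr (fun=> 2^-1)) => [|u _]; last by rewrite /=; lra.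
  rewrite mulNr subrr addr0 big_const_seq iter_mulr_1 count_predT size_children.
  by rewrite /= -/q -exprM [q + 1]addrC.
apply: bit_avg_le => y _; rewrite /G.
have zE z : agree_off (levels n.+1 (h + K)) y z -> zero_children z V = zero_children y V.
  move=> yz; apply: eq_zero_children => u /(allP sU) /= /eqP su.
  by rewrite yz // mem_levels su ltnn.
have -> : \prod_(u <- children V) (if y u then 1 else q) = q ^+ size (zero_children y V).
  rewrite /zero_children size_filter -iter_mulr_1 -big_const_seq [RHS]big_mkcond.
  by apply: eq_bigr => u _; case: (y u).
have PE : \prod_(u <- children V) (y u == (u != w0))%:R <=
    (zero_children y V == [:: w0])%:R :> R.
  rewrite prod_indicator ler_nat // /zero_children.
  case: allP => //= yU; suff -> : [seq u <- children V | ~~ y u] = [:: w0] by rewrite eqxx.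
  rewrite (eq_in_filter (a2 := pred1 w0)) => [|u /yU /eqP ->]; last by rewrite negbK.
  by rewrite filter_pred1_uniq // UE mem_head.
rewrite (prod_indicator _ y).
have sz := zero_children_size y sV.
have uz : uniq (zero_children y V) by rewrite filter_uniq.
case E: (zero_children y V) PE sz uz zE => [|w [|w' V']] PE sz uz zE.
- have -> : all y (children V).
    by apply/negPn; rewrite -has_predC has_filter; move: E; rewrite /zero_children => ->.
  have := avg_ge0 (levels n.+1 (h + K)) (hole K h.+1 V) y.
  move: PE => /=; rewrite expr0; nra.
- apply: (@le_trans _ _ (zero_prob K)).
    have a0 : (0 : R) <= (all y (children V))%:R by [].
    have : (([:: w] : seq (seq bool)) == [:: w0])%:R <= 1 :> R by case: (_ == _).
    by rewrite expr1; nra.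
  rewrite -(@avg_all_zero K h n.+1 w y); last by move: sz => /=; rewrite andbT => /eqP.
  by apply: bit_avg_le => z /zE /= ->; rewrite ler_nat; case: (all _ _).
- have a0 : (0 : R) <= (all y (children V))%:R by [].
  apply: (@le_trans _ _ (zero_prob K / 2 * q ^+ size [:: w, w' & V'])).
    have k2 : 0 <= zero_prob K / 2 by rewrite divr_ge0 // ltW.
    rewrite gerDl mulNr subr_le0; apply: ler_wpM2l => //; apply: le_trans PE _.
    by rewrite (_ : (_ == _) = false) //; apply/eqP => -[].
  apply: le_trans (IH n.+1 _ y uz _ sz) _ => //.
  by apply: bit_avg_le => z /zE /= ->.
Qed.
End Hole.

(** * Fair bits *)

Section FairBits.
Context (d : measure_display) (T : measurableType d) (R : realType).
Variables (P : probability T R) (b : seq bool -> T -> bool).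

Definition bits_event (J : seq (seq bool)) (s : seq bool -> bool) : set T :=
  [set t | all (fun v => b v t == s v) J].

Definition fair_bits : Prop :=
  (forall v, (0 < size v)%N -> measurable [set t | b v t]) /\
  forall J s, uniq J -> all (fun v => 0 < size v)%N J ->
    P (bits_event J s) = ((2^-1) ^+ size J)%:E.

Hypothesis b_fair : fair_bits.

Lemma measurable_bits_event J s :
  all (fun v => 0 < size v)%N J -> measurable (bits_event J s).
Proof.
elim: J => [_|v J IH /= /andP[v0 /IH mJ]].
  by rewrite (_ : bits_event _ _ = setT) //; apply/seteqP; split.
rewrite (_ : bits_event _ _ = (if s v then [set t | b v t] else ~` [set t | b v t])
   `&` bits_event J s).
  have mv := b_fair.1 v v0.
  by apply: measurableI => //; case: (s v) => //; apply: measurableC.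
apply/seteqP; split => t /=; rewrite /bits_event /=.
  by case/andP => /eqP <- ->; split => //; case: (boolP (b v t)) => //= /negP.
by case=> + ->; case: (s v) => /= [->|/negP/negPf ->].
Qed.

(** Induction on [J], splitting on its first bit. The cylinder over [I] makes the statement
    inductive: the bit just fixed moves from [J] to [I]. *)
Lemma fair_bits_avg J (phi : (seq bool -> bool) -> bool) :
  uniq J -> all (fun v => 0 < size v)%N J ->
  (forall x y, {in J, x =1 y} -> phi x = phi y) ->
  measurable [set t | phi (b^~ t)] /\
  forall x0 I s, uniq (J ++ I) -> all (fun v => 0 < size v)%N I ->
    P ([set t | phi (b^~ t)] `&` bits_event I s) =
    (bit_avg J (fun y => (phi y)%:R) x0 * (2^-1) ^+ size I)%:E.
Proof.
elim: J phi => [|v J IH] phi /=.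
  move=> _ _ phiE; split.
    rewrite (_ : [set t | _] = if phi (fun=> false) then setT else set0).
      by case: (phi _).
    apply/seteqP; split => t /=; rewrite (phiE (b^~ t) (fun=> false)) //.
      by move=> ->.
    by case: (phi _).
  move=> x0 I s uI I0; rewrite (_ : [set t | _] = if phi x0 then setT else set0).
    case: (phi x0); rewrite ?setTI ?set0I ?mul1r ?mul0r ?measure0 //.
    by rewrite b_fair.2.
  apply/seteqP; split => t /=; rewrite (phiE (b^~ t) x0) //; first by move=> ->.
  by case: (phi _).
move=> /andP[vJ uJ] /andP[v0 J0] phiE.
pose psi e (x : seq bool -> bool) := phi (set_bit x v e).
have psiE e x y : {in J, x =1 y} -> psi e x = psi e y.
  move=> xy; apply: phiE => u; rewrite inE /set_bit.
  by case: eqVneq => //= _; exact: xy.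
have psib e x : x v = e -> phi x = psi e x.
  by move=> xv; apply: phiE => u _; rewrite /set_bit; case: eqVneq => // ->.
have mb := b_fair.1 v v0.
have mpsi e := (IH (psi e) uJ J0 (psiE e)).1.
have phiS : [set t | phi (b^~ t)] =
   ([set t | psi true (b^~ t)] `&` [set t | b v t]) `|`
   ([set t | psi false (b^~ t)] `\` [set t | b v t]).
  apply/seteqP; split => t /=.
    case bv: (b v t); first by rewrite (psib true) //; left.
    by rewrite (psib false) // => ?; right; split.
  case=> [[+ bv]|[+ /negP/negPf bv]].
    by rewrite -psib.
  by rewrite -psib.
have mphi : measurable [set t | phi (b^~ t)].
  by rewrite phiS; apply: measurableU; [apply: measurableI|apply: measurableD].
split=> // x0 I s; rewrite mem_cat negb_or => /andP[/andP[_ vI] uJI] I0.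
have split_bit e : P ([set t | phi (b^~ t)] `&` bits_event I s `&`
      [set t | b v t == e]) =
    (bit_avg J (fun y => (phi y)%:R) (set_bit x0 v e) * (2^-1) ^+ (size I).+1)%:E.
  rewrite (_ : _ `&` _ = [set t | psi e (b^~ t)] `&` bits_event (v :: I) (set_bit s v e)).
    rewrite ((IH (psi e) uJ J0 (psiE e)).2 (set_bit x0 v e)) /= ?v0 //; last first.
      move: uJI; rewrite !cat_uniq /= negb_or vJ vI /=.
      by case/and3P => -> -> ->.
    congr ((_ * _)%:E); apply: eq_bit_avg => y /(_ v vJ); rewrite /set_bit eqxx => yv.
    by rewrite -psib.
  have allE t : all (fun u => b u t == s u) I = all (fun u => b u t == set_bit s v e u) I.
    apply: eq_in_all => u uI; rewrite /set_bit; case: (eqVneq u v) => // uv.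
    by rewrite -uv uI in vI.
  apply/seteqP; split => t; rewrite /bits_event /=.
    by case=> -[pt It] /eqP bv; rewrite -psib // /set_bit eqxx bv eqxx /= -allE.
  by rewrite {1}/set_bit eqxx => -[+ /andP[/eqP bv]]; rewrite -psib // -allE bv eqxx.
rewrite (measureDI P (B := [set t | b v t])) //; last first.
  by apply: measurableI => //; apply: measurable_bits_event.
rewrite -setIA [X in (X + _)%E](_ : _ = P ([set t | phi (b^~ t)] `&` bits_event I s `&`
      [set t | b v t == false])); last first.
  congr (P _); apply/seteqP; split => t /= [+ bv]; split => //.
    by apply/eqP/negP.
  by rewrite (eqP bv).
rewrite setIA [X in (_ + X)%E](_ : _ = P ([set t | phi (b^~ t)] `&` bits_event I s `&`
      [set t | b v t == true])); last first.
  by congr (P (_ `&` _)); apply/seteqP; split => t /= /eqP.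
by rewrite !split_bit -EFinD; congr (_%:E); rewrite exprS; ring.
Qed.

Lemma fair_bits_event n (phi : (seq bool -> bool) -> bool) :
  (forall x y, {in levels 0 n, x =1 y} -> phi x = phi y) ->
  measurable [set t | phi (b^~ t)] /\
  forall x0, P [set t | phi (b^~ t)] =
    (bit_avg (levels 0 n) (fun y => (phi y)%:R) x0)%:E.
Proof.
move=> phiE.
have J0 : all (fun v => 0 < size v)%N (levels 0 n).
  by apply/allP => v; rewrite mem_levels => /andP[].
have [mphi Pphi] := fair_bits_avg (levels_uniq 0 n) J0 phiE.
split=> // x0; have := Pphi x0 [::] xpredT; rewrite cats0 levels_uniq => /(_ isT isT).
rewrite expr0 mulr1 => <-; congr (P _).
by apply/seteqP; split => t //= [].
Qed.

(** * Events of conditional probability bounded below occur infinitely often *)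

Section InfinitelyOften.
Variables (lev st : nat -> nat) (G : nat -> (seq bool -> bool) -> bool) (delta : R).
Hypothesis levS : forall j, lev j.+1 = (lev j + st j)%N.
Hypothesis GE : forall j x y, {in levels 0 (lev j.+1), x =1 y} -> G j x = G j y.
Hypothesis delta_gt0 : 0 < delta.
Hypothesis delta_le1 : delta <= 1.
Hypothesis G_ge : forall j x,
  delta <= bit_avg (levels (lev j) (st j)) (fun y => (G j y)%:R) x.

Let bad N L x := all (fun j => ~~ G j x) (iota N L).

Let lev_mono i j : (i <= j)%N -> (lev i <= lev j)%N.
Proof.
move=> /subnK <-; elim: (j - i)%N => // k IH; rewrite addSn levS.
exact: leq_trans IH (leq_addr _ _).
Qed.

Let badE N L x y : {in levels 0 (lev (N + L)), x =1 y} -> bad N L x = bad N L y.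
Proof.
move=> xy; apply: eq_in_all => j; rewrite mem_iota => /andP[_ jL].
congr (~~ _); apply: GE => u; rewrite mem_levels => /andP[u0 uj]; apply: xy.
by rewrite mem_levels u0 /=; apply: leq_trans uj _; rewrite !add0n lev_mono.
Qed.

(** Average over the last block first: the earlier events are then constant, and since [G_ge] holds
    for every past, each block costs a factor [1 - delta]. *)
Let avg_bad N L x :
  bit_avg (levels 0 (lev (N + L))) (fun y => (bad N L y)%:R) x <= (1 - delta) ^+ L.
Proof.
elim: L => [|L IH].
  by rewrite expr0 (_ : (fun=> _) = fun=> 1) ?bit_avg_cst.
rewrite addnS levS levelsD bit_avg_cat add0n exprS.
apply: le_trans (ler_wpM2l _ IH); last by rewrite subr_ge0.
rewrite -bit_avgZ; apply: bit_avg_le => y _.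
rewrite (_ : bit_avg _ _ _ = bit_avg (levels (lev (N + L)) (st (N + L)))
   (fun z => (bad N L y)%:R + - (bad N L y)%:R * (G (N + L)%N z)%:R) y).
  rewrite bit_avgD bit_avgZ bit_avg_cst; have := G_ge (N + L) y.
  by case: (bad N L y) => /=; rewrite ?mulr0n ?mulr1n; nra.
apply: eq_bit_avg => z yz; rewrite (_ : bad N L.+1 z = bad N L y && ~~ G (N + L)%N z).
  by case: (bad N L y); case: (G _ z) => /=; rewrite ?mulr0n ?mulr1n; lra.
rewrite /bad -addn1 iotaD all_cat /= andbT; congr (_ && _).
apply: badE => u; rewrite mem_levels add0n => /andP[_ uL].
by apply: yz; rewrite mem_levels ltnNge uL.
Qed.

(** Failing from [N] on means failing [L] times for every [L], which has probability at most
    [(1 - delta) ^+ L]; then take the union over [N]. *)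
Lemma fair_bits_infinitely_often :
  {ae P, forall t, forall N, exists2 j, (N <= j)%N & G j (b^~ t)}.
Proof.
pose B N := \bigcap_L [set t | bad N L (b^~ t)].
have mbad N L : measurable [set t | bad N L (b^~ t)].
  exact: (fair_bits_event (@badE N L)).1.
have B0 N : P (B N) = 0%E.
  have mB : measurable (B N) by apply: bigcapT_measurable.
  apply/eqP; rewrite eq_le measure_ge0 andbT.
  have le_pow L : (P (B N) <= ((1 - delta) ^+ L)%:E)%E.
    apply: (@le_trans _ _ (P [set t | bad N L (b^~ t)])).
      by apply: le_measure; rewrite ?inE //; apply: bigcap_inf.
    by rewrite ((fair_bits_event (@badE N L)).2 (fun=> false)) lee_fin avg_bad.
  have cv : (fun L => ((1 - delta) ^+ L)%:E) @ \oo --> 0%:E.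
    apply: cvg_EFin; first by near=> L.
    apply: cvg_expr; rewrite ger0_norm ?subr_ge0 // ltrBlDr ltrDl //.
  rewrite -[leRHS](cvg_lim (@ereal_hausdorff R) cv); apply: lime_ge; last exact: nearW.
  by apply/cvg_ex; exists 0%E.
have : P.-negligible (\bigcup_N B N).
  by apply: negligible_bigcup => N; exists (B N); split; [exact: bigcapT_measurable|exact: B0|].
apply: negligibleS => t /existsNP[N Nt]; exists N => // L _ /=.
apply/allP => j; rewrite mem_iota => /andP[Nj _]; apply/negP => Gj.
by apply: Nt; exists j.
Unshelve. all: by end_near. Qed.
End InfinitelyOften.
End FairBits.

(** * Geometry of the support *)

Lemma take_prefix (w : nat -> bool) m n : (m <= n)%N ->
  take m (Defs.prefix w n) = Defs.prefix w m.
Proof. by move=> mn; rewrite /Defs.prefix /mkseq -map_take take_iota (minn_idPl mn). Qed.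

Lemma size_prefix (w : nat -> bool) n : size (Defs.prefix w n) = n.
Proof. exact: size_mkseq. Qed.

Section Position.
Variables (R : realType) (lam : R).
Hypothesis lam01 : 0 < lam < 1.
Implicit Types (x : seq bool -> bool) (u v : seq bool) (w : nat -> bool).

Definition pos x v : R := \sum_(1 <= j < (size v).+1) (x (take j v))%:R * lam ^+ j.

Definition pos_lim x w : R :=
  limn (fun n => \sum_(1 <= j < n) (x (Defs.prefix w j))%:R * lam ^+ j).

(* The total mass [lam + lam ^ 2 + ...] that the tail of a branch can add. *)
Definition tail : R := lam / (1 - lam).

Let lam_ge0 : 0 <= lam. Proof. by case/andP: lam01 => /ltW. Qed.

Lemma tail_gt0 : 0 < tail.
Proof. by case/andP: lam01 => l0 l1; rewrite divr_gt0 // subr_gt0. Qed.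

Lemma exp_small (C e : R) : 0 < e ->
  exists N, forall n, (N <= n)%N -> lam ^+ n * C < e.
Proof.
move=> e0; have l1 : `|lam| < 1 by rewrite ger0_norm //; case/andP: lam01.
have /cvgrPdist_lt/(_ e e0)[N _ NP] := cvg_geometric C l1.
exists N => n /NP /=; rewrite /geometric /= sub0r normrN mulrC.
exact: le_lt_trans (ler_norm _).
Qed.

Lemma eq_pos x y v : (forall j, (0 < j <= size v)%N -> x (take j v) = y (take j v)) ->
  pos x v = pos y v.
Proof. by move=> xy; apply: eq_big_nat => j; rewrite ltnS => /xy ->. Qed.

Lemma pos_ge0 x v : 0 <= pos x v.
Proof. by apply: sumr_ge0 => j _; rewrite mulr_ge0 ?exprn_ge0. Qed.

Lemma pos_cat x v n : (n <= size v)%N -> pos x v =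
  pos x (take n v) + \sum_(n.+1 <= j < (size v).+1) (x (take j v))%:R * lam ^+ j.
Proof.
move=> nv; rewrite /pos (@big_cat_nat _ _ _ n.+1) //=; congr (_ + _).
rewrite size_takel //; apply: eq_big_nat => j /andP[_ jn].
by rewrite -take_min (minn_idPl _).
Qed.

Lemma pos_take_le x v n : (n <= size v)%N -> pos x (take n v) <= pos x v.
Proof.
move=> nv; rewrite (pos_cat x nv) lerDl.
by apply: sumr_ge0 => j _; rewrite mulr_ge0 ?exprn_ge0.
Qed.

Lemma pos_take_eqP x v n : (n <= size v)%N ->
  pos x v = pos x (take n v) <->
  (forall j, (n < j <= size v)%N -> x (take j v) = false).
Proof.
move=> nv; rewrite (pos_cat x nv); split.
  move/eqP; rewrite -subr_eq0 addrAC subrr add0r psumr_eq0; last first.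
    by move=> j _; rewrite mulr_ge0 ?exprn_ge0.
  move=> /allP x0 j jn; have := x0 j; rewrite mem_index_iota ltnS => /(_ jn) /=.
  case: (x _) => //; rewrite mul1r expf_eq0 gt_eqF ?andbF //.
  by case/andP: lam01.
move=> x0; rewrite big_nat_cond big1 ?addr0 // => j /andP[jn _].
by rewrite x0 // mul0r.
Qed.

Lemma pos_prefix x w n :
  \sum_(1 <= j < n.+1) (x (Defs.prefix w j))%:R * lam ^+ j = pos x (Defs.prefix w n).
Proof.
rewrite /pos size_prefix; apply: eq_big_nat => j /andP[_ jn].
by rewrite take_prefix.
Qed.

Lemma pos_prefix_le x w m n : (m <= n)%N ->
  pos x (Defs.prefix w m) <= pos x (Defs.prefix w n).
Proof.
by move=> mn; rewrite -(take_prefix w mn) pos_take_le // size_prefix.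
Qed.

(** The subtracted term makes the bound inductive: the mass beyond level [n + k] drops by exactly
    the largest increment possible at the next level. *)
Lemma pos_prefix_ge x w n k :
  pos x (Defs.prefix w (n + k)) <=
  pos x (Defs.prefix w n) + lam ^+ n * tail - lam ^+ (n + k) * tail.
Proof.
elim: k => [|k IH]; first by rewrite addn0; lra.
rewrite addnS -pos_prefix big_nat_recr //= pos_prefix.
have -> : lam ^+ (n + k).+1 * tail = lam ^+ (n + k) * tail - lam ^+ (n + k).+1.
  rewrite /tail exprS; case/andP: lam01 => l0 l1; field.
  by rewrite subr_eq0 eq_sym lt_eqF.
have : (x (Defs.prefix w (n + k).+1))%:R * lam ^+ (n + k).+1 <= lam ^+ (n + k).+1.
  by rewrite ler_piMl ?exprn_ge0 // lern1 leq_b1.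
by lra.
Qed.

Lemma pos_lim_bounds x w n :
  pos x (Defs.prefix w n) <= pos_lim x w <= pos x (Defs.prefix w n) + lam ^+ n * tail.
Proof.
rewrite /pos_lim; set u := fun n => _.
have uS k : u k.+1 = pos x (Defs.prefix w k) by exact: pos_prefix.
have u_nd : {homo u : i j / (i <= j)%N >-> i <= j}.
  apply/nondecreasing_seqP => k; rewrite /u; case: k => [|k].
    by rewrite !big_geq.
  by rewrite [leRHS]big_nat_recr //= lerDl mulr_ge0 ?exprn_ge0.
have u_le k : u k <= pos x (Defs.prefix w n) + lam ^+ n * tail.
  apply: (@le_trans _ _ (u (n + k).+1)); first by apply: u_nd; lia.
  rewrite uS; apply: le_trans (pos_prefix_ge x w n k) _.
  by rewrite gerBl mulr_ge0 ?exprn_ge0 // ltW // tail_gt0.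
have cv : cvgn u.
  apply: nondecreasing_is_cvgn => //.
  by exists (pos x (Defs.prefix w n) + lam ^+ n * tail) => _ [k _ <-].
apply/andP; split; first by rewrite -uS; apply: nondecreasing_cvgn_le.
by apply: limr_le => //; apply: nearW.
Qed.

Lemma pos_negb x v : pos (fun u => ~~ x u) v + pos x v = tail - lam ^+ size v * tail.
Proof.
rewrite /pos -big_split /=.
under eq_bigr => j _.
  rewrite -mulrDl (_ : _ + _ = 1); last by case: (x _); rewrite /= ?addr0 ?add0r.
  rewrite mul1r; over.
elim: (size v) => [|n IH]; first by rewrite big_geq // expr0 mul1r subrr.
rewrite big_nat_recr //= IH exprS /tail; case/andP: lam01 => l0 l1; field.
by rewrite subr_eq0 eq_sym lt_eqF.
Qed.

(** The identity holds for prefixes of length [n] up to errors of order [lam ^+ n]. It says that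
    exchanging zeros and ones reflects the support. *)
Lemma pos_lim_negb x w : pos_lim (fun u => ~~ x u) w = tail - pos_lim x w.
Proof.
apply/eqP; rewrite eq_sym subr_eq; set s := (X in _ == X).
have near_tail n : `|tail - s| <= lam ^+ n * tail.
  have := pos_lim_bounds x w n; have := pos_lim_bounds (fun u => ~~ x u) w n.
  have := pos_negb x (Defs.prefix w n); rewrite size_prefix -/tail /s ler_norml.
  by move=> ?; do 2!case/andP => ? ?; apply/andP; split; lra.
rewrite -subr_eq0 -normr_le0 leNgt; apply/negP => /(exp_small tail)[N /(_ N (leqnn N))].
by rewrite ltNge near_tail.
Qed.

(** * Minimising words, and the hole next to the minimum *)

Definition candidates r n x := [seq v <- words n | r <= pos x v].

Definition minimisers r n x :=
  [seq v <- candidates r n x | all (fun u => pos x v <= pos x u) (candidates r n x)].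

Lemma eq_minimisers r n x y : {in levels 0 n, x =1 y} ->
  minimisers r n x = minimisers r n y.
Proof.
move=> xy; have pE v : size v = n -> pos x v = pos y v.
  move=> vn; apply: eq_pos => j; rewrite vn => jn; apply: xy.
  by rewrite mem_levels add0n size_takel // vn; case/andP: jn.
have cE : candidates r n x = candidates r n y.
  by apply: eq_in_filter => v; rewrite mem_words => /eqP /pE ->.
rewrite /minimisers cE; apply: eq_in_filter => v.
rewrite mem_filter mem_words => /andP[_ /eqP vn].
by apply: eq_in_all => u; rewrite mem_filter mem_words => /andP[_ /eqP un]; rewrite !pE.
Qed.

Lemma minimisers_size r n x : all (fun v => size v == n) (minimisers r n x).
Proof.
by apply/allP => v; rewrite !mem_filter mem_words => /and3P[].
Qed.

Lemma minimisers_uniq r n x : uniq (minimisers r n x).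
Proof. by rewrite !filter_uniq // words_uniq. Qed.

Lemma size_minimisers r n x : (size (minimisers r n x) <= 2 ^ n)%N.
Proof.
rewrite -size_words !size_filter; apply: leq_trans (count_size _ _) _.
by rewrite size_filter count_size.
Qed.

Lemma exists_min (s : seq (seq bool)) (f : seq bool -> R) : s != [::] ->
  exists2 v, v \in s & all (fun u => f v <= f u) s.
Proof.
elim: s => // u s IH _; have [->|/IH[v vs /allP vmin]] := eqVneq s [::].
  by exists u; rewrite ?mem_head //= lexx.
have [uv|vu] := leP (f u) (f v).
  exists u; rewrite ?mem_head //= lexx; apply/allP => z /vmin; exact: le_trans.
exists v; rewrite ?inE ?vs ?orbT //= (ltW vu); exact/allP.
Qed.

Lemma minimisers_neq0 r n x v : size v = n -> r <= pos x v -> minimisers r n x != [::].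
Proof.
move=> vn rv; have c0 : candidates r n x != [::].
  apply/eqP => c0; have : v \in candidates r n x by rewrite mem_filter rv mem_words vn eqxx.
  by rewrite c0.
have [u uc umin] := exists_min (pos x) c0; apply/eqP => m0.
have : u \in minimisers r n x by rewrite mem_filter umin.
by rewrite m0.
Qed.

Lemma mem_zero_children n V x u : all (fun v => size v == n) V -> (n < size u)%N ->
  (take n.+1 u \in zero_children x V) = (take n u \in V) && ~~ x (take n.+1 u).
Proof. by move=> sV nu; rewrite mem_filter (take_nth false nu) mem_children andbC. Qed.

(** [u] is the lone survivor at the successful generation; a word [v] of the same length that also
    starts in [V] and reads only zeros would be in the same list of survivors. *)
Lemma holeP K h n V x : all (fun v => size v == n) V -> hole K h V x ->
  exists u, [/\ (n < size u)%N, take n u \in V,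
    forall j, (n < j <= size u)%N -> x (take j u) = false,
    all (fun z => ~~ x z) (below K u) &
    forall v, size v = size u -> take n v \in V ->
      (forall j, (n < j <= size u)%N -> x (take j v) = false) -> v = u].
Proof.
elim: h n V => //= h IH n V sV; have sV' := zero_children_size x sV.
case/orP => [|/(IH n.+1 _ sV')[u [nu + u0 bu uniqu]]].
  case E: (zero_children x V) => [|u []] // bu; exists u.
  have un : size u = n.+1 by move: sV'; rewrite E /= andbT => /eqP.
  have take1 v : size v = n.+1 -> take n.+1 v = v by move=> vn; rewrite take_oversize ?vn.
  have := @mem_zero_children n V x u sV.
  rewrite un take1 // E mem_head => /(_ (ltnSn n))/esym/andP[uV xu].
  split => //.
    move=> j jn; have -> : j = n.+1 by lia.
    by rewrite take1 //; apply/negbTE.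
  move=> v vn vV v0; have := @mem_zero_children n V x v sV.
  rewrite vn take1 // E inE vV /= => /(_ (ltnSn n)) vu.
  apply/eqP; rewrite vu; have := v0 n.+1; rewrite take1 ?vn // => -> //.
  by rewrite ?ltnSn ?leqnn.
rewrite (mem_zero_children _ sV) ?(ltnW nu) // => /andP[uV xu].
exists u; split => //; first exact: ltnW.
  move=> j /andP[nj ju]; have [jn|] := eqVneq j n.+1; first by rewrite jn; apply/negbTE.
  by move=> jn; apply: u0; rewrite ju andbT ltn_neqAle eq_sym jn.
move=> v vu vV v0; apply: uniqu => //.
  rewrite (mem_zero_children _ sV) ?vu ?(ltnW nu) // vV v0 // ltnSn.
  exact: ltnW.
by move=> j /andP[nj ju]; apply: v0; rewrite ju (ltnW nj).
Qed.

Definition extend u : nat -> bool := nth false u.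

Lemma prefix_extend u : Defs.prefix (extend u) (size u) = u.
Proof. exact: mkseq_nth. Qed.

Variables (c : R) (K : nat).
Hypothesis separation : forall x u v, size u = size v -> pos x u != pos x v ->
  c * lam ^+ size u <= `|pos x u - pos x v|.
Hypothesis Kc : lam ^+ K * tail < c.

(** Branches through [u] read [K] zeros and so stay close to [mu]. Any other branch starting at or
    above [r] differs from [mu] at level [size u], by uniqueness of the survivor, and separation
    applies. By [Kc] an interval is left free. *)
Lemma hole_gap r n h x : hole K h (minimisers r n x) x ->
  exists u, let mu := pos x u in
  [/\ (n < size u)%N, r <= mu,
    forall v, size v = n -> r <= pos x v -> mu <= pos x v,
    forall w, Defs.prefix w (size u) = u ->
      mu <= pos_lim x w <= mu + lam ^+ size u * (lam ^+ K * tail) &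
    forall w, Defs.prefix w (size u) != u -> r <= pos x (Defs.prefix w n) ->
      mu + lam ^+ size u * c <= pos_lim x w].
Proof.
move=> /(holeP (minimisers_size _ _ _))[u [nu uV u0 bu uniqu]].
have uE : pos x u = pos x (take n u) by apply/(pos_take_eqP _ (ltnW nu)).
have := uV; rewrite !mem_filter => /and3P[/allP umin ru _].
have mu_le v : size v = n -> r <= pos x v -> pos x u <= pos x v.
  by move=> vn rv; rewrite uE umin // mem_filter rv mem_words vn eqxx.
exists u; split => //; first by rewrite uE.
- move=> w wu; suff E : pos x u = pos x (Defs.prefix w (size u + K)).
    by rewrite mulrA -exprD E pos_lim_bounds.
  rewrite -{1}wu -(take_prefix w (leq_addr K (size u))); apply/esym.
  apply/pos_take_eqP; rewrite size_prefix ?leq_addr // => j /andP[uj jK].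
  rewrite take_prefix //; apply/negbTE; apply: (allP bu); apply/mapP.
  exists (drop (size u) (Defs.prefix w j)).
    by rewrite mem_levels size_drop size_prefix add0n; lia.
  by rewrite -{1}wu -(take_prefix w (ltnW uj)) cat_take_drop.
move=> w wu rw; set v := Defs.prefix w (size u) in wu.
have vu : size v = size u by rewrite size_prefix.
have tv : take n v = Defs.prefix w n by rewrite take_prefix // ltnW.
have nv : (n <= size v)%N by rewrite vu ltnW.
have mun := mu_le _ (size_prefix w n) rw.
have uv : pos x u <= pos x v.
  by apply: le_trans mun _; rewrite -tv pos_take_le.
apply: le_trans (andP (pos_lim_bounds x w (size u))).1; rewrite -/v.
have [E|ne] := eqVneq (pos x v) (pos x u); last first.
  have := separation vu ne; rewrite vu ger0_norm ?subr_ge0 // mulrC.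
  by lra.
(* In the case of equality, [v] has stayed at the minimum since level [n]: its prefix is a minimiser
   and all later bits are zero, so [v] would be a second survivor. *)
have vE : pos x v = pos x (take n v).
  by apply/le_anti; rewrite pos_take_le // tv E mun.
case/eqP: wu; apply: uniqu => //.
  rewrite !mem_filter mem_words tv size_prefix eqxx rw !andbT; apply/allP => z.
  by rewrite mem_filter mem_words => /andP[rz /eqP zn]; rewrite -tv -vE E mu_le.
by rewrite -vu; apply/pos_take_eqP.
Qed.

Variable H : nat -> nat.

(** The empty case counts as success to make the probability bound uniform in the past; wherever a
    hole is needed, some branch lies above [r] and excludes it. *)
Definition hole_or_empty (r : R) x n :=
  (minimisers r n x == [::]) || hole K (H n) (minimisers r n x) x.

Lemma right_gap_not_isolated x (y beta eps : R) :
  (forall q : rat, forall N, exists2 n, (N <= n)%N & hole_or_empty (ratr q) x n) ->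
  y < beta -> range (pos_lim x) beta ->
  (forall z, y <= z < beta -> ~ range (pos_lim x) z) -> 0 < eps ->
  ~ (`]beta, beta + eps[ `<=` range (pos_lim x)).
Proof.
move=> holes yb [w0 _ w0E] gap eps0 sub.
(* The threshold [q] lies inside the gap, and [n] is so large that a branch below [q] at level [n]
   cannot reach [beta]. *)
have [q] := rat_in_itvoo yb; rewrite in_itv /= => /andP[yq qb].
have [N1 N1P] : exists N, forall n, (N <= n)%N -> lam ^+ n * tail < beta - ratr q.
  by apply: exp_small; rewrite subr_gt0.
have [N2 N2P] := exp_small c eps0.
have [n Nn] := holes q (maxn N1 N2).
have /N1P lt1 := leq_trans (leq_maxl N1 N2) Nn.
have n2 := leq_trans (leq_maxr N1 N2) Nn.
have w0b := pos_lim_bounds x w0 n; rewrite w0E in w0b.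
have rw0 : ratr q <= pos x (Defs.prefix w0 n) by lra.
rewrite /hole_or_empty (negPf (minimisers_neq0 (size_prefix w0 n) rw0)) /=.
case/hole_gap => u [nu ru mu_le win wout]; set mu := pos x u in ru mu_le win wout.
have := win _ (prefix_extend u); set f1 := pos_lim x _ => f1b.
have bf1 : beta <= f1.
  rewrite leNgt; apply/negP => f1lt; apply: (gap f1); last by exists (extend u).
  by lra.
have mub := mu_le _ (size_prefix w0 n) rw0.
have lu : 0 < lam ^+ size u by rewrite exprn_gt0 //; case/andP: lam01.
have ltc : lam ^+ size u * (lam ^+ K * tail) < lam ^+ size u * c by rewrite ltr_pM2l.
have /N2P lt2 := leq_trans n2 (ltnW nu).
(* The midpoint of the free interval. It exceeds [beta] because the branch extending [u] has value
   at least [q] and so, by the gap, at least [beta]; it is below [beta + eps] because [mu <= beta]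
   and [n] is large. *)
pose z := mu + (lam ^+ size u * (lam ^+ K * tail) + lam ^+ size u * c) / 2.
have [w _ wz] : range (pos_lim x) z.
  by apply: sub; rewrite /= in_itv /= /z; lra.
have [/win|/wout] := eqVneq (Defs.prefix w (size u)) u; first by rewrite wz /z; lra.
have [rw /(_ isT)|rw _] := leP (ratr q) (pos x (Defs.prefix w n)); first by rewrite wz /z; lra.
by have := pos_lim_bounds x w n; rewrite wz /z; lra.
Qed.

Lemma range_pos_lim_disconnected x n :
  hole_or_empty 0 x n -> ~ connected (range (pos_lim x)).
Proof.
rewrite /hole_or_empty (negPf (minimisers_neq0 (size_nseq n false) (pos_ge0 x _))) /=.
case/hole_gap => u [nu _ _ win wout]; set mu := pos x u in win wout.
have win1 := win _ (prefix_extend u).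
(* This branch leaves [u] at the first letter, so it lies beyond the hole; with threshold 0 every
   word is a candidate. *)
pose w2 i := ~~ extend u i.
have ltc : lam ^+ size u * (lam ^+ K * tail) < lam ^+ size u * c.
  by rewrite ltr_pM2l // exprn_gt0 //; case/andP: lam01.
have w2u : Defs.prefix w2 (size u) != u.
  apply/eqP => /(congr1 (nth false ^~ 0%N)); rewrite nth_mkseq; last by case: (size u) nu.
  by rewrite /w2 /extend; case: (nth _ _ _).
have := wout _ w2u (pos_ge0 _ _) => wout2.
pose z := mu + (lam ^+ size u * (lam ^+ K * tail) + lam ^+ size u * c) / 2.
move=> /connected_intervalP itv.
have [w _ wz] : range (pos_lim x) z.
  apply: (itv (pos_lim x (extend u)) (pos_lim x w2)); [by eexists|by eexists|].
  by rewrite /z; lra.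
have [/win|/wout/(_ (pos_ge0 _ _))] := eqVneq (Defs.prefix w (size u)) u.
  by rewrite wz /z; lra.
by rewrite wz /z; lra.
Qed.

End Position.

(** As [lam ^+ j = lam ^+ n * theta ^+ (n - j)], the difference is [lam ^+ n] times the value at
    [theta] of a polynomial with coefficients -1, 0 or 1, to which Garsia's bound applies. *)
Lemma pisot_separation (R : realType) (theta lam : R) : pisot theta -> lam = theta^-1 ->
  exists2 c : R, 0 < c & forall x u v, size u = size v -> pos lam x u != pos lam x v ->
    c * lam ^+ size u <= `|pos lam x u - pos lam x v|.
Proof.
move=> [theta1 [p [pm [pirr [pth conj]]]]] lamE.
have [c c0 sep] := garsia_separation pm pirr pth conj.
have th0 : theta != 0 by rewrite gt_eqF // (lt_trans ltr01).
have lam0 : 0 < lam by rewrite lamE invr_gt0 (lt_trans ltr01).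
exists c => // x u v uv ne; set n := size u.
pose e j : int := (x (take j u))%:Z - (x (take j v))%:Z.
pose q : {poly int} := \poly_(i < n) e (n - i)%N.
have qE : pos lam x u - pos lam x v = lam ^+ n * (map_poly (intr : int -> R) q).[theta].
  have -> : map_poly (intr : int -> R) q = \poly_(i < n) (e (n - i)%N)%:~R.
    by apply/polyP => i; rewrite coef_map !coef_poly; case: ifP.
  rewrite horner_poly /pos -uv -/n -sumrB big_add1 big_mkord /= mulr_sumr.
  rewrite (reindex_inj rev_ord_inj) /=; apply: eq_bigr => i _.
  rewrite -subSn // subSS -mulrBl /e rmorphB /= -!pmulrn mulrCA.
  have -> : lam ^+ n = lam ^+ (n - i) * lam ^+ i by rewrite -exprD subnK // ltnW.
  by rewrite -mulrA -exprMn [lam * _](_ : _ = 1) ?expr1n ?mulr1 // lamE mulVf.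
have q1 i : `|q`_i| <= 1.
  rewrite coef_poly; case: ifP => // _; rewrite /e.
  by case: (x _); case: (x _).
have q0 : (map_poly (intr : int -> R) q).[theta] != 0.
  by apply: contra_neq ne => q0; apply/eqP; rewrite -subr_eq0 qE q0 mulr0.
rewrite qE normrM ger0_norm ?exprn_ge0 ?(ltW lam0) // mulrC ler_pM2l ?exprn_gt0 //.
exact: sep.
Qed.

(** * From the binary model to holes at infinitely many levels *)

Section AlmostSure.
Context (d : measure_display) (T : measurableType d) (R : realType).
Variables (P : probability T R).

Lemma ae_forall_count (I : countType) (Q : I -> T -> Prop) :
  (forall i, {ae P, forall t, Q i t}) -> {ae P, forall t, forall i, Q i t}.
Proof.
move=> aeQ; have : {ae P, forall t, forall n, if unpickle n is Some i then Q i t else True}.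
  apply: ae_foralln => n; case: (unpickle n) => [i|]; first exact: aeQ.
  by apply: aeW.
by apply: filterS => t Qt i; have := Qt (pickle i); rewrite pickleK.
Qed.

Lemma fair_bits_negb (b : seq bool -> T -> bool) : fair_bits P b ->
  fair_bits P (fun v t => ~~ b v t).
Proof.
move=> [mb Pb]; split.
  move=> v /mb mv; rewrite (_ : [set t | _] = ~` [set t | b v t]); first exact: measurableC.
  by apply/seteqP; split => t /= /negP.
move=> J s uJ J0; rewrite -(Pb J (fun v => ~~ s v)) //; congr (P _).
have E t : all (fun v => (~~ b v t) == s v) J = all (fun v => b v t == ~~ s v) J.
  by apply: eq_all => v; case: (b v t); case: (s v).
by apply/seteqP; split => t; rewrite /bits_event /= E.
Qed.

Lemma binary_model_fair_bits (a : seq bool -> T -> R) : binary_model P a ->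
  fair_bits P (fun v t => a v t == 1).
Proof.
move=> [ma [_ [P1 indep]]].
have bE v : [set t | a v t == 1] = a v @^-1` [set 1].
  by apply/seteqP; split => t /= /eqP.
have m1 v : (0 < size v)%N -> measurable (a v @^-1` [set 1]).
  by move=> v0; rewrite -[X in measurable X]setTI; apply: ma.
split; first by move=> v v0; rewrite bE; apply: m1.
move=> J s uJ J0; pose B v : set R := if s v then [set 1] else ~` [set 1].
have mB v : measurable (B v) by rewrite /B; case: (s v) => //; apply: measurableC.
have PB v : v \in J -> P (a v @^-1` B v) = (2^-1)%:E.
  move=> /(allP J0) v0; rewrite /B; case: (s v); first exact: P1.
  rewrite -preimage_setC probability_setC; last exact: m1.
  by rewrite P1 // -EFinB; congr (_%:E); lra.
have -> : bits_event (fun v t => a v t == 1) J s = \big[setI/setT]_(v <- J) (a v @^-1` B v).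
  rewrite -bigcap_seq; apply/seteqP; split => t.
    move=> /allP st v /st /eqP; rewrite /B /preimage /=.
    by case: (s v) => /eqP //; move=> /eqP/negbT/eqP.
  move=> Bt; apply/allP => v /Bt; rewrite /B /preimage /=.
  by case: (s v) => [->|/eqP/negbTE ->]; rewrite ?eqxx.
rewrite indep // big_seq; under eq_bigr => v vJ do rewrite PB //.
rewrite -big_seq big_const_seq count_predT; elim: (size J) => //= n ->.
by rewrite exprS EFinM.
Qed.

Lemma binary_model_bits (a : seq bool -> T -> R) : binary_model P a ->
  {ae P, forall t, forall v, (0 < size v)%N -> a v t = (a v t == 1)%:R}.
Proof.
move=> [ma [P0 [P1 _]]]; apply: ae_forall_count => v.
have [v0|v0] := boolP (0 < size v)%N; last by apply: aeW.
have m z : measurable (a v @^-1` [set z]).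
  by rewrite -[X in measurable X]setTI; apply: ma.
exists (~` (a v @^-1` [set 0] `|` a v @^-1` [set 1])); split.
- by apply: measurableC; apply: measurableU.
- rewrite probability_setC; last exact: measurableU.
  rewrite measureU //; last by apply/seteqP; split => t //= -[-> /eqP]; rewrite eq_sym oner_eq0.
  transitivity (1%:E - ((2^-1)%:E + (2^-1)%:E) : \bar R)%E.
    by congr (1%:E - (_ + _))%E; [exact: P0|exact: P1].
  by rewrite -!EFinD; congr (_%:E); lra.
- move=> t /= nt at01; apply: nt => _.
  case: at01 => /= ->; rewrite ?eqxx // eq_sym oner_eq0 //.
Qed.

Variables (lam : R) (K : nat).

(** From level [n], a block allows [2 ^ (n + 3)] generations for extinction and [K] more for the
    final descent of zeros. *)
Fixpoint block j := if j is i.+1 then (block i + (2 ^ (block i + 3) + K))%N else 0%N.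

Lemma leq_block j : (j <= block j)%N.
Proof.
elim: j => //= j IH; apply: leq_ltn_trans IH _.
by rewrite -[ltnLHS]addn0 ltn_add2l addn_gt0 expn_gt0.
Qed.

Lemma fair_bits_holes (b : seq bool -> T -> bool) : fair_bits P b ->
  {ae P, forall t, forall (q : rat) N, exists2 n, (N <= n)%N &
    hole_or_empty lam K (fun n => 2 ^ (n + 3))%N (ratr q) (b^~ t) n}.
Proof.
move=> bf; apply: ae_forall_count => q.
pose G j x := hole_or_empty lam K (fun n => 2 ^ (n + 3))%N (ratr q) x (block j).
(* The factor [zero_prob R K / 2] comes from [avg_hole_ge], the last one half from extinction within
   the block. *)
pose delta : R := zero_prob R K / 2 * 2^-1.
have z0 := zero_prob_gt0 R K.
have z1 : zero_prob R K <= 1 by rewrite exprn_ile1 ?invr_ge0 // invf_le1 // ler1n.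
have dep j x y : {in levels 0 (block j.+1), x =1 y} ->
    minimisers lam (ratr q) (block j) x = minimisers lam (ratr q) (block j) y.
  move=> xy; apply: eq_minimisers => v vj; apply: xy; move: vj.
  by rewrite !mem_levels !add0n /= => /andP[-> /= vj]; apply: leq_trans vj (leq_addr _ _).
have io : {ae P, forall t, forall N, exists2 j, (N <= j)%N & G j (b^~ t)}.
  apply: (@fair_bits_infinitely_often _ _ _ _ _ bf block
    (fun j => 2 ^ (block j + 3) + K)%N G delta) => //.
  - move=> j x y xy; rewrite /G /hole_or_empty (dep j x y xy); congr (_ || _).
    apply: (eq_hole (minimisers_size _ _ _ _)) => u un; apply: xy.
    by rewrite mem_levels add0n /=; lia.
  - by rewrite /delta; lra.
  - by rewrite /delta; lra.
  - move=> j x; set n := block j.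
    have minE y : agree_off (levels n (2 ^ (n + 3) + K)) x y ->
        minimisers lam (ratr q) n y = minimisers lam (ratr q) n x.
      move=> xy; apply: eq_minimisers => v; rewrite mem_levels add0n => /andP[_ vn].
      by apply: xy; rewrite mem_levels ltnNge vn.
    have [m0|m0] := eqVneq (minimisers lam (ratr q) n x) [::].
      rewrite -(@bit_avg_cst R _ (levels n (2 ^ (n + 3) + K)) delta x); apply: bit_avg_le.
      move=> y /minE yE; rewrite /G /hole_or_empty -/n yE m0 eqxx /=; rewrite /delta; lra.
    have := @avg_hole_ge R K (2 ^ (n + 3)) n _ x (minimisers_uniq _ _ _ _) m0
      (minimisers_size _ _ _ _).
    move=> le_hole; apply: le_trans (le_trans _ le_hole) _; last first.
      by apply: bit_avg_le => y /minE yE; rewrite /G /hole_or_empty -/n yE (negPf m0).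
    rewrite /delta ler_pM2l ?divr_gt0 //; apply: le_trans (ext_prob_pow_ge R n) _.
    have /andP[q0 q1] := ext_prob_itv R (2 ^ (n + 3)).
    by rewrite ler_wiXn2l // size_minimisers.
apply: filterS io => t Gt N; have [j Nj Gj] := Gt N.
by exists (block j) => //; apply: leq_trans Nj (leq_block j).
Qed.
End AlmostSure.

(** * Finite end points of a gap *)

Section ComponentEnds.
Variables (R : realType) (S : set R) (alpha beta : \bar R) (x : R).
Hypothesis xS : ~ S x.
Hypothesis comp : eitv alpha beta = connected_component (~` S) x.

Let x_in : eitv alpha beta x.
Proof. by rewrite comp; apply: connected_component_refl. Qed.

Let notin z : eitv alpha beta z -> ~ S z.
Proof. by rewrite comp => /connected_component_sub. Qed.

(** If [be] were outside [S], the segment from [x] to [be] would be a connected subset of the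
    complement, which puts [be] into the open interval it bounds. *)
Lemma component_right_end (be : R) : beta = be%:E ->
  [/\ x < be, S be & forall z, x <= z < be -> ~ S z].
Proof.
move=> bE; have [ax xb] := x_in; rewrite bE lte_fin in xb.
have gap z : x <= z < be -> ~ S z.
  case/andP => xz zb; apply: notin; split; last by rewrite bE lte_fin.
  by apply: lt_le_trans ax _; rewrite lee_fin.
split => //; apply: contrapT => beS.
suff : eitv alpha beta be by case; rewrite bE ltxx.
rewrite comp; apply: (@connected_component_max _ _ `[x, be]).
- by rewrite /= in_itv /= lexx ltW.
- move=> z; rewrite /= in_itv /= => /andP[xz]; rewrite le_eqVlt => /predU1P[->//|zb].
  by apply: gap; rewrite xz.
- by apply/connected_intervalP; apply: interval_is_interval.
- by rewrite /= in_itv /= lexx ltW.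
Qed.

Lemma component_left_end (al : R) : alpha = al%:E ->
  [/\ al < x, S al & forall z, al < z <= x -> ~ S z].
Proof.
move=> aE; have [ax xb] := x_in; rewrite aE lte_fin in ax.
have gap z : al < z <= x -> ~ S z.
  case/andP => az zx; apply: notin; split; first by rewrite aE lte_fin.
  by apply: le_lt_trans _ xb; rewrite lee_fin.
split => //; apply: contrapT => alS.
suff : eitv alpha beta al by case; rewrite aE ltxx.
rewrite comp; apply: (@connected_component_max _ _ `[al, x]).
- by rewrite /= in_itv /= lexx ltW.
- move=> z; rewrite /= in_itv /= => /andP[]; rewrite le_eqVlt => /predU1P[<-//|az] zx.
  by apply: gap; rewrite az.
- by apply/connected_intervalP; apply: interval_is_interval.
- by rewrite /= in_itv /= lexx ltW.
Qed.
End ComponentEnds.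

(** * Almost sure conclusion at both ends of every gap *)

Theorem theorem1p9 (d : measure_display) (T : measurableType d) (R : realType)
    (P : probability T R) (a : seq bool -> T -> R) (lambda theta : R) :
  binary_model P a ->
  0 < lambda < 1 ->
  pisot theta ->
  lambda = theta^-1 ->
  {ae P, forall t : T,
    ~ connected (attractor a lambda t) /\
    forall (alpha beta : \bar R) (x : R),
      ~ attractor a lambda t x ->
      eitv alpha beta = connected_component (~` attractor a lambda t) x ->
      (forall al : R, alpha = al%:E ->
         forall eps : R, 0 < eps -> ~ (`]al - eps, al[ `<=` attractor a lambda t)) /\
      (forall be : R, beta = be%:E ->
         forall eps : R, 0 < eps -> ~ (`]be, be + eps[ `<=` attractor a lambda t))}.
Proof.
move=> model l01 pis lamE.
have [c c0 sep] := pisot_separation pis lamE.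
have [K /(_ K (leqnn K)) Kc] := exp_small l01 (tail lambda) c0.
have fair := binary_model_fair_bits model.
have holes := fair_bits_holes lambda K fair.
have nholes := fair_bits_holes lambda K (fair_bits_negb fair).
apply: filterS3 (binary_model_bits model) holes nholes => t bits {}holes {}nholes.
set x := fun v => a v t == 1 in holes; set nx := fun v => ~~ x v.
have -> : attractor a lambda t = range (pos_lim lambda x).
  rewrite /attractor; suff -> : Defs.fmap a lambda t = pos_lim lambda x by [].
  apply/funext => w; rewrite /Defs.fmap /pos_lim; congr (limn _).
  apply/funext => n; apply: eq_big_nat => j /andP[j0 _].
  by rewrite bits // size_prefix.
have rangeN z : range (pos_lim lambda x) (tail lambda - z) <-> range (pos_lim lambda nx) z.
  split=> -[w _ wz]; exists w => //.
    by rewrite pos_lim_negb // wz opprB addrC subrK.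
  by rewrite -wz pos_lim_negb // opprB addrC subrK.
split.
  have [n _] := holes 0 0%N; rewrite rmorph0.
  exact: (range_pos_lim_disconnected l01 sep Kc).
move=> alpha beta y yS comp; split=> [al alE|be beE] eps eps0 sub; last first.
  have [yb bS gap] := component_right_end yS comp beE.
  exact: (right_gap_not_isolated l01 sep Kc holes yb bS gap eps0 sub).
have [ay aS gap] := component_left_end yS comp alE.
(* Under the reflection [z] to [tail lambda - z] the left end [al] becomes the right end of a gap of
   the support for the negated bits. *)
have ay' : tail lambda - y < tail lambda - al by rewrite ltrD2l ltrN2.
apply: (right_gap_not_isolated l01 sep Kc nholes ay' _ _ eps0).
- by apply/rangeN; rewrite subKr.
- by move=> z zy /rangeN; apply: gap; lra.
- move=> z; rewrite /= in_itv /= => zy; apply/rangeN; apply: sub.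
  by rewrite /= in_itv /=; lra.
Qed.
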